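(* Let $\Lambda$ be a finite dimensional algebra. Let $\mathcal{T}$ be a torsion class in $\mathrm{mod}\,\Lambda$ which has a canonical join representation in $\mathrm{tors}\,\Lambda$ of the form $\mathrm{CJR}(\mathcal{T})=\bigvee_{\alpha\in A}\mathcal{T}_{M_\alpha}$, where the $M_\alpha$ are $\Lambda$-bricks. Then $\bar\kappa(\mathcal{T})$ is defined and $$\bar\kappa(\mathcal{T})=\bigcap_{\alpha\in A}{}^{\perp}M_\alpha .$$
   Context: Modules are finitely generated. A torsion class is a full subcategory of $\mathrm{mod}\,\Lambda$ closed under isomorphisms, quotients and extensions. $\mathrm{tors}\,\Lambda$ is the complete lattice of torsion classes ordered by inclusion (meet is intersection). A brick is a module whose endomorphism ring is a division ring. $\mathrm{Gen}(M)$ is the class of quotients of finite direct sums of copies of $M$; $\mathrm{Filt}(\mathcal{C})$ is the class of modules with a finite filtration with successive quotients in $\mathcal{C}$; $\mathcal{T}_M=\mathrm{Filt}(\mathrm{Gen}(M))$. ${}^{\perp}M=\{X\in\mathrm{mod}\,\Lambda:\mathrm{Hom}_\Lambda(X,M)=0\}$. A join representation $x=\bigvee A$ in a lattice $L$ is irredundant if $\bigvee A'<x$ for each proper subset $A'\subsetneq A$. The join representation $\bigvee A$ is lower than $\bigvee B$ if for each $a\in A$ there is $b\in B$ with $a\le b$. The canonical join representation $\mathrm{CJR}(x)$ is the unique lowest irredundant join representation among all irredundant join representations of $x$, when it exists; we write $j\in\mathrm{CJR}(x)$ for the elements (joinands) appearing in it. An element $j$ is completely join-irreducible if $j=\bigvee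 A$ implies $j\in A$; then $j_*$ denotes the unique element covered by $j$, and $\kappa(j)$ is the unique maximum of $\{x\in L: j_*\le x,\ j\not\le x\}$, when it exists. It is known that the torsion classes $\mathcal{T}_M$ ($M$ a brick) are exactly the completely join-irreducible elements of $\mathrm{tors}\,\Lambda$. If $x$ has a canonical join representation such that $\kappa(j)$ is defined for each $j\in\mathrm{CJR}(x)$ (and the meet below exists), then $\bar\kappa(x):=\bigwedge\{\kappa(j):j\in\mathrm{CJR}(x)\}$. *)

(* Defs.v *)
From HB Require Import structures.
From mathcomp Require Import all_boot all_order all_algebra all_field.
From mathcomp Require Import boolp classical_sets.

Set Implicit Arguments.
Unset Strict Implicit.
Unset Printing Implicit Defensive.

Import GRing.Theory.

(* The collection of all torsion classes of a module category lives in a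
   universe above that of lmodType, hence above those that porderType and the
   type [set T] of classical_sets can accommodate. This is why posets, and
   families of their elements (as predicates), are set up directly here. *)

Record poset := Poset {
  poset_sort :> Type;
  ple : poset_sort -> poset_sort -> Prop;
  ple_refl : forall x, ple x x;
  ple_anti : forall x y, ple x y -> ple y x -> x = y;
  ple_trans : forall x y z, ple x y -> ple y z -> ple x z }.

Section CanonicalJoinRepresentations.
Context {L : poset}.
Implicit Types (x y z j k : L) (A B : L -> Prop).

Definition plt x y := ple x y /\ x <> y.

Definition is_join A x :=
  (forall a, A a -> ple a x) /\
  (forall y, (forall a, A a -> ple a y) -> ple x y).

Definition is_meet A x :=
  (forall a, A a -> ple x a) /\
  (forall y, (forall a, A a -> ple y a) -> ple y x).

Definition proper_subfamily A B :=
  (forall a, A a -> B a) /\ (exists2 b, B b & ~ A b).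

Definition irredundant_join_rep x A :=
  is_join A x /\ (forall B y, proper_subfamily B A -> is_join B y -> plt y x).

Definition lower_join_rep A B := forall a, A a -> exists2 b, B b & ple a b.

(* Uniqueness of the lowest representation is automatic: see [is_CJR_unique]. *)
Definition is_CJR x A :=
  irredundant_join_rep x A /\
  (forall B, irredundant_join_rep x B -> lower_join_rep A B).

Definition completely_join_irreducible j := forall A, is_join A j -> A j.

Definition covers x y := plt y x /\ (forall z, ~ (plt y z /\ plt z x)).

Definition is_lower_star j js := covers j js /\ (forall y, covers j y -> y = js).

(* [is_kappa j k] means that j is completely join-irreducible and that kappa(j)
   is defined and equals k. *)
Definition is_kappa j k :=
  completely_join_irreducible j /\
  exists js, [/\ is_lower_star j js,
                 ple js k /\ ~ ple j k &
                 forall x, ple js x -> ~ ple j x -> ple x k].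

(* [is_kappabar x y] means that kappa-bar(x) is defined and equals y. *)
Definition is_kappabar x y :=
  exists A, [/\ is_CJR x A,
                forall j, A j -> exists k, is_kappa j k &
                is_meet (fun k => exists2 j, A j & is_kappa j k) y].

(* The relations above are partial functions. *)

Lemma irredundant_antichain x A a b :
  irredundant_join_rep x A -> A a -> A b -> ple a b -> a = b.
Proof.
move=> [[ubx lbx] irrA] Aa Ab leab; apply: contrapT => neab.
have ltA : proper_subfamily (fun c => A c /\ c <> a) A.
  by split=> [c []//|]; exists a => // -[].
suff : plt x x by case.
apply: irrA ltA _; split=> [c [/ubx]//|y uby]; apply: lbx => c Ac.
have [->|neca] := pselect (c = a); last exact: uby.
by apply: ple_trans leab _; apply: uby; split=> // eba; apply: neab.
Qed.

Lemma is_CJR_unique x A B : is_CJR x A -> is_CJR x B -> A = B.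
Proof.
move=> [irrA lowA] [irrB lowB].
have sub A1 B1 : irredundant_join_rep x A1 -> lower_join_rep A1 B1 ->
    lower_join_rep B1 A1 -> forall a, A1 a -> B1 a.
  move=> irr1 lAB lBA a Aa; have [b Bb leab] := lAB a Aa.
  have [a' Aa' leba'] := lBA b Bb.
  have eaa' := irredundant_antichain irr1 Aa Aa' (ple_trans leab leba').
  suff -> : a = b by [].
  by apply: ple_anti leab _; rewrite eaa'.
by apply/funext => a; apply/propext; split; apply: sub; auto.
Qed.

Lemma is_kappa_unique j k k' : is_kappa j k -> is_kappa j k' -> k = k'.
Proof.
move=> [_ [js [[_ ujs] [lek jk] maxk]]] [_ [js' [[cjs' _] [lek' jk'] maxk']]].
have e := ujs _ cjs'; rewrite {}e in lek' maxk'.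
by apply: ple_anti; [apply: maxk'|apply: maxk].
Qed.

Lemma is_meet_unique A x y : is_meet A x -> is_meet A y -> x = y.
Proof. by move=> [lx gx] [ly gy]; apply: ple_anti; [apply: gy|apply: gx]. Qed.

Lemma is_kappabar_unique x y y' : is_kappabar x y -> is_kappabar x y' -> y = y'.
Proof.
move=> [A [cA _ iy]] [B [cB _ iy']].
rewrite (is_CJR_unique cB cA) in iy'.
exact: is_meet_unique iy iy'.
Qed.

End CanonicalJoinRepresentations.

Section ModuleCategory.
Local Open Scope classical_set_scope.
Local Open Scope ring_scope.
Variables (k : fieldType) (Lambda : falgType k).

Definition finitely_generated (X : lmodType Lambda) :=
  exists n (g : 'I_n -> X),
    forall x, exists c : 'I_n -> Lambda, x = \sum_(i < n) c i *: g i.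

(* The objects of mod Lambda; modules are left modules. As an falgType, Lambda
   is unital with 1 != 0. *)
Record fgmod := Fgmod {
  fgmod_sort :> lmodType Lambda;
  fgmodP : finitely_generated fgmod_sort }.

Implicit Types (X Y Z M : fgmod) (C : fgmod -> Prop).

Definition short_exact X Y Z (f : {linear X -> Y}) (g : {linear Y -> Z}) :=
  [/\ injective f, range f = [set y | g y = 0] & range g = setT].

Definition iso_closed C := forall X Y (f : {linear X -> Y}),
  bijective f -> C X -> C Y.

Definition quotient_closed C := forall X Y (f : {linear X -> Y}),
  range f = setT -> C X -> C Y.

Definition extension_closed C :=
  forall X Y Z (f : {linear X -> Y}) (g : {linear Y -> Z}),
  short_exact f g -> C X -> C Z -> C Y.

(* The empty class is excluded: given closure under quotients, nonemptiness
   amounts to containing the zero module. *)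
Definition is_torsion_class C :=
  [/\ exists X, C X, iso_closed C, quotient_closed C & extension_closed C].

Record torsion_class := TorsionClass {
  in_tors :> fgmod -> Prop;
  torsP : is_torsion_class in_tors }.

Definition tors_le (T U : torsion_class) := forall X, T X -> U X.

Lemma tors_le_refl T : tors_le T T. Proof. by []. Qed.

Lemma tors_le_anti T U : tors_le T U -> tors_le U T -> T = U.
Proof.
case: T U => [T hT] [U hU] /= TU UT.
have e : T = U by apply/funext => X; apply/propext; split; [apply: TU|apply: UT].
by case: _ / e hU {TU UT} => hU; congr TorsionClass; apply: Prop_irrelevance.
Qed.

Lemma tors_le_trans T U V : tors_le T U -> tors_le U V -> tors_le T V.
Proof. by move=> TU UV X /TU/UV. Qed.

Definition tors : poset := Poset tors_le_refl tors_le_anti tors_le_trans.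

Lemma fg_zero : finitely_generated 'rV[Lambda]_0.
Proof. by exists 0%N, (fun=> 0) => x; exists (fun=> 0); rewrite big_ord0 thinmx0. Qed.

Lemma tors_zero (T : tors) : in_tors T (Fgmod fg_zero).
Proof.
have [[X TX] _ quoT _] := torsP T.
apply: (quoT X _ (\0 : {linear X -> Fgmod fg_zero})) TX.
by apply/seteqP; split=> // x _; exists 0 => //; rewrite thinmx0 [RHS]thinmx0.
Qed.

(* Hence tors is a complete lattice, whose meets are intersections. *)
Lemma tors_meet (S : tors -> Prop) :
  exists2 U : tors, is_meet S U &
    in_tors U = fun X => forall T, S T -> in_tors T X.
Proof.
have tU : is_torsion_class (fun X => forall T, S T -> in_tors T X).
  split.
  - by exists (Fgmod fg_zero) => T _; apply: tors_zero.
  - by move=> X Y f bf SX T ST; have [_ + _ _] := torsP T; apply; eauto.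
  - by move=> X Y f sf SX T ST; have [_ _ + _] := torsP T; apply; eauto.
  - by move=> X Y Z f g fg SX SZ T ST; have [_ _ _ +] := torsP T; apply; eauto.
exists (TorsionClass tU) => //; split=> [T ST X|V VS X VX T ST]; first exact.
exact: VS.
Qed.

(* End(M) is a division ring: the first conjunct is 1 <> 0 in End(M). *)
Definition brick M :=
  (exists x : M, x <> 0) /\
  (forall f : {linear M -> M}, (exists x, f x <> 0) ->
     exists g : {linear M -> M}, cancel f g /\ cancel g f).

Definition Gen M : fgmod -> Prop :=
  fun X => exists n (f : {linear {ffun 'I_n -> M} -> X}), range f = setT.

(* For submodules N, P of X with N contained in P, this says that P / N is
   isomorphic to Z, the isomorphism being given as a linear surjection g from P
   onto Z with kernel N; the values of g outside P are irrelevant. *)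
Definition subquotient_iso X (P N : set X) Z :=
  exists g : X -> Z,
    [/\ forall a x y, P x -> P y -> g (a *: x + y) = a *: g x + g y,
        g @` P = setT &
        forall x, P x -> (g x = 0 <-> N x)].

Definition Filt C : fgmod -> Prop :=
  fun X => exists n (F : nat -> set X),
    [/\ forall i, submod_closed (mem (F i)),
        F 0%N = [set 0],
        F n = setT &
        forall i, (i < n)%N -> F i `<=` F i.+1 /\
          exists2 Z, C Z & subquotient_iso (F i.+1) (F i) Z].

(* The class of the X in mod Lambda with Hom(X, M) = 0. *)
Definition lperp M : fgmod -> Prop :=
  fun X => forall (f : {linear X -> M}) x, f x = 0.

End ModuleCategory.

(* Main.v *)
From HB Require Import structures.
Require Import Defs.
From mathcomp Require Import all_boot all_order all_algebra all_field.
From mathcomp Require Import boolp classical_sets.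

Set Implicit Arguments.
Unset Strict Implicit.
Unset Printing Implicit Defensive.

Import GRing.Theory.
Local Open Scope classical_set_scope.
Local Open Scope ring_scope.

(* Write J for the torsion class of a brick M. It consists of the modules all of
   whose nonzero quotients receive a nonzero map from M, which is compared with
   Filt (Gen M) by repeatedly adding the image of a map from M to X / N.
   If U < J is a torsion class then Hom(X, M) = 0 for X in U: the image I of a
   nonzero X -> M would be in U, hence in J, so the composite of a nonzero
   M -> I with I -> M would be bijective, I = M would be in U and J <= U. Thus
   J is completely join-irreducible, with lower star J :&: lperp M. If U
   contains this lower star and some X with a nonzero map to M, of image I, then
   U contains I, and also M / I because a nonzero map M / I -> M would give a
   non-injective nonzero endomorphism of M; so U contains M by extension. Hence
   kappa(J) = lperp M. *)

(** * Quotient modules *)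

Section QuotientModule.
Variables (R : nzRingType) (V : lmodType R) (I : zmodClosed V).
Hypothesis IZ : GRing.scaler_closed I.

Definition quot_pi (x : V) : Quotient.quot I := \pi_(Quotient.quot I)%qT x.

Lemma quot_pi_eq x y : (quot_pi x = quot_pi y) <-> (x - y \in I).
Proof. by rewrite Quotient.idealrBE; split=> [/eqP|/eqP]. Qed.

Lemma quot_pi_repr (q : Quotient.quot I) :
  quot_pi (generic_quotient.repr q) = q.
Proof. exact: reprK. Qed.

Lemma quot_piB x y : quot_pi (x - y) = quot_pi x - quot_pi y.
Proof. by rewrite /quot_pi !piE. Qed.

HB.instance Definition _ :=
  GRing.isZmodMorphism.Build V (Quotient.quot I) quot_pi quot_piB.

Lemma quot_piD x y : quot_pi (x + y) = quot_pi x + quot_pi y.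
Proof. exact: raddfD. Qed.

(** Scales a chosen representative; [quot_piZ] shows, by [IZ], that the choice does not matter. *)
Definition quot_scale (a : R) (q : Quotient.quot I) : Quotient.quot I :=
  quot_pi (a *: generic_quotient.repr q).

Lemma quot_piZ a x : quot_pi (a *: x) = quot_scale a (quot_pi x).
Proof.
apply/quot_pi_eq; rewrite -scalerBr; apply: IZ.
by apply/quot_pi_eq; rewrite quot_pi_repr.
Qed.

Lemma quot_pi_surj (q : Quotient.quot I) : exists x, q = quot_pi x.
Proof. by exists (generic_quotient.repr q); rewrite quot_pi_repr. Qed.

Lemma quot_scaleA a b q : quot_scale a (quot_scale b q) = quot_scale (a * b) q.
Proof. by have [x ->] := quot_pi_surj q; rewrite -!quot_piZ scalerA. Qed.

Lemma quot_scale1 : left_id 1 quot_scale.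
Proof.
by move=> q; have [x ->] := quot_pi_surj q; rewrite -quot_piZ scale1r.
Qed.

Lemma quot_scaleDr : right_distributive quot_scale +%R.
Proof.
move=> a q r; have [x ->] := quot_pi_surj q; have [y ->] := quot_pi_surj r.
by rewrite -quot_piD -!quot_piZ -quot_piD scalerDr.
Qed.

Lemma quot_scaleDl q : {morph quot_scale^~ q : a b / a + b}.
Proof.
move=> a b; have [x ->] := quot_pi_surj q.
by rewrite -!quot_piZ -quot_piD scalerDl.
Qed.

Definition quot_lmod : lmodType R := HB.pack (Quotient.quot I)
  (GRing.Zmodule_isLmodule.Build R (Quotient.quot I)
    quot_scaleA quot_scale1 quot_scaleDr quot_scaleDl).

Lemma quot_pi_linear : linear (quot_pi : V -> quot_lmod).
Proof. by move=> a x y; rewrite quot_piD quot_piZ. Qed.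

End QuotientModule.

(** * Factorizations of linear maps, and quotients by submodules given as sets *)

Section Linear.
Variables (R : nzRingType).
Implicit Types (V W : lmodType R).

Lemma linear_exists V W (f : V -> W) : linear f ->
  exists g : {linear V -> W}, forall x, g x = f x.
Proof.
move=> lf; pose l := GRing.isLinear.Build R V W _ f lf.
by exists (HB.pack f l : {linear V -> W}).
Qed.

(** A section [s] of [g] is a mere function, but [h] does not see the kernel of [g], so [h \o s] is
    linear. *)
Lemma factor_surj V W (Z : lmodType R)
    (g : {linear V -> W}) (h : {linear V -> Z}) :
  range g = setT -> (forall x, g x = 0 -> h x = 0) ->
  exists h' : {linear W -> Z}, forall x, h' (g x) = h x.
Proof.
move=> gT gh.
have /choice[s sK] : forall y, exists x, g x = y.
  move=> y; have [x _ <-] : range g y by rewrite gT.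
  by exists x.
have hs x : h (s (g x)) = h x.
  by apply/eqP; rewrite -subr_eq0 -linearB gh // linearB sK subrr.
have [|h' h'E] := @linear_exists W Z (h \o s).
  move=> a x y /=; rewrite -linearP -[RHS]hs linearP !sK//.
by exists h' => x; rewrite h'E /= hs.
Qed.

Lemma factor_inj V W (Z : lmodType R)
    (i : {linear V -> W}) (f : {linear Z -> W}) :
  injective i -> (forall x, range i (f x)) ->
  exists f' : {linear Z -> V}, forall x, i (f' x) = f x.
Proof.
move=> inji fi.
have /choice[s sK] : forall x, exists y, i y = f x.
  by move=> x; have [y _ <-] := fi x; exists y.
have [|f' f'E] := @linear_exists Z V s.
  by move=> a x y; apply: inji; rewrite linearP !sK linearP.
by exists f' => x; rewrite f'E.
Qed.

Lemma linear_inj0 V W (f : {linear V -> W}) :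
  (forall x, f x = 0 -> x = 0) -> injective f.
Proof.
by move=> f0 x y /eqP; rewrite -subr_eq0 -linearB => /eqP/f0/subr0_eq.
Qed.

Definition submodule V (N : set V) :=
  N 0 /\ forall (a : R) x y, N x -> N y -> N (a *: x + y).

Lemma submodule_mem V (N : set V) : submodule N -> submod_closed (mem N).
Proof.
move=> [N0 NP]; split; first exact/mem_set.
by move=> a x y /set_mem Nx /set_mem Ny; apply/mem_set/NP.
Qed.

Lemma submodule_preimage V W (f : {linear V -> W}) (N : set W) :
  submodule N -> submodule (f @^-1` N).
Proof.
move=> [N0 NP]; split=> [|a x y]; rewrite /preimage /= ?linear0//.
by rewrite linearP; apply: NP.
Qed.

Lemma submodule_range V W (f : {linear V -> W}) : submodule (range f).
Proof.
split; first by exists 0; rewrite ?linear0.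
by move=> a _ _ [x _ <-] [y _ <-]; exists (a *: x + y); rewrite ?linearP.
Qed.

Lemma quotient_exists V (N : set V) : submodule N ->
  exists (W : lmodType R) (q : {linear V -> W}),
    range q = setT /\ forall x, q x = 0 <-> N x.
Proof.
(* The quotient construction takes a boolean predicate: [b] decides [N] classically. *)
move=> sN; pose b (x : V) := `[< N x >].
have cb : submod_closed b.
  split; first by apply/asboolP; case: sN.
  move=> a x y /asboolP Nx /asboolP Ny; apply/asboolP.
  by case: sN => _; apply.
have cz : zmod_closed b by exact: GRing.submod_closedB cb.
have bZ : GRing.scaler_closed b.
  by move=> a x bx; have [b0 bP] := cb; rewrite -[_ *: _]addr0 bP.
pose c := GRing.isZmodClosed.Build V b cz.
pose I : zmodClosed V := HB.pack b c.
have [q qE] := linear_exists (@quot_pi_linear R V I bZ).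
exists _, q; split.
  apply/seteqP; split=> // y _; have [x ->] := quot_pi_surj y.
  by exists x; rewrite ?qE.
move=> x; rewrite -(linear0 q) !qE quot_pi_eq subr0.
by split=> [/asboolP|Nx] //; apply/asboolP.
Qed.

End Linear.

(** A subspace of maximal dimension inside [P] is all of [P]: adding to it the line of some [v] in
    [P] stays inside [P], so cannot raise the dimension. *)
Lemma submodule_vspace (K : fieldType) (vT : vectType K) (P : set vT) :
  submodule P -> exists U : {vspace vT}, forall v, v \in U <-> P v.
Proof.
move=> [P0 PP].
pose good d :=
  `[< exists2 U : {vspace vT}, \dim U = d & forall v, v \in U -> P v >].
have good0 : exists d, good d.
  exists 0%N; apply/asboolP; exists 0%VS; first exact: dimv0.
  by move=> v; rewrite memv0 => /eqP->.
have goodle d : good d -> (d <= \dim {:vT})%N.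
  by move=> /asboolP[U <- _]; exact: dimvS (subvf U).
case: (ex_maxnP good0 goodle) => d /asboolP[U <- UP] maxU {d}.
exists U => v; split=> [/UP//|Pv].
have UvP w : w \in (U + <[v]>)%VS -> P w.
  by move=> /memv_addP[u /UP Pu [_ /vlineP[c ->] ->]]; rewrite addrC; apply: PP.
have le := maxU (\dim (U + <[v]>)%VS) (asboolT (ex_intro2 _ _ _ erefl UvP)).
have -> : U = (U + <[v]>)%VS by apply/eqP; rewrite eqEdim addvSl le.
by rewrite memvE addvSr.
Qed.

(** * Finiteness properties of modules, through dimension over [k] *)

Section FiniteLength.
Variables (k : fieldType) (Lambda : falgType k).
Implicit Types (X Y Z M : fgmod Lambda).

(* The map p is k-linear for the action c%:A *: x of k on X, which is not
   declared as a k-module. *)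
Lemma fg_cover X : exists (vT : vectType k) (p : vT -> X),
  range p = setT /\ forall (c : k) u v, p (c *: u + v) = c%:A *: p u + p v.
Proof.
have [n [g gX]] := fgmodP X.
exists {ffun 'I_n -> Lambda},
  (fun u : {ffun 'I_n -> Lambda} => \sum_(i < n) u i *: g i); split.
  apply/seteqP; split=> // x _; have [c ->] := gX x.
  by exists (finfun c) => //; apply: eq_bigr => i _; rewrite ffunE.
move=> c u v; rewrite scaler_sumr -big_split; apply: eq_bigr => i _ /=.
by rewrite !ffunE scalerDl scalerA -scalerAl mul1r.
Qed.

Lemma semilinear0 (vT : vectType k) X (p : vT -> X) :
  (forall (c : k) u v, p (c *: u + v) = c%:A *: p u + p v) -> p 0 = 0.
Proof. by move=> /(_ (-1) 0 0); rewrite !scaleN1r oppr0 addr0 addNr. Qed.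

Lemma submodule_cover (vT : vectType k) X (p : vT -> X) (N : set X) :
  (forall (c : k) u v, p (c *: u + v) = c%:A *: p u + p v) ->
  submodule N -> exists U : {vspace vT}, forall v, v \in U <-> N (p v).
Proof.
move=> plin [N0 NP]; apply: submodule_vspace (p @^-1` N) _; split=> [|a x y].
  by rewrite /preimage /= (semilinear0 plin).
by rewrite /preimage /= plin; apply: NP.
Qed.

Lemma fg_surj X (W : lmodType Lambda) (f : {linear X -> W}) :
  range f = setT -> finitely_generated W.
Proof.
move=> fT; have [n [g gX]] := fgmodP X; exists n, (f \o g) => w.
have [x _ <-] : range f w by rewrite fT.
have [c ->] := gX x; exists c; rewrite linear_sum; apply: eq_bigr => i _.
by rewrite linearZ.
Qed.

Lemma fg_row n : finitely_generated 'rV[Lambda]_n.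
Proof.
exists n, (delta_mx 0) => u; exists (u 0); exact: row_sum_delta.
Qed.

Lemma cokernel X (N : set X) : submodule N ->
  exists (Z : fgmod Lambda) (q : {linear X -> Z}),
    range q = setT /\ forall x, q x = 0 <-> N x.
Proof.
move=> /quotient_exists[W [q [qT qN]]].
by exists (Fgmod (fg_surj qT)), q.
Qed.

Lemma image_factor X Y (f : {linear X -> Y}) :
  exists (I : fgmod Lambda) (p : {linear X -> I}) (i : {linear I -> Y}),
    [/\ range p = setT, injective i & forall x, i (p x) = f x].
Proof.
have [|I [p [pT pf]]] := @cokernel X [set x | f x = 0].
  split=> [|a x y /= fx fy]; rewrite /= ?linear0//.
  by rewrite linearP fx fy scaler0 addr0.
have [|i ip] := factor_surj pT (h := f); first by move=> x /pf.
exists I, p, i; split=> //; apply: linear_inj0 => z.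
have [x _ <-] : range p z by rewrite pT.
by rewrite ip => /pf.
Qed.

(** The image of a [k]-basis of the preimage of [N] in the cover generates [N], so [N] is the image
    of a free module of finite rank. *)
Lemma submodule_fg X (N : set X) : submodule N ->
  exists (Y : fgmod Lambda) (i : {linear Y -> X}), injective i /\ range i = N.
Proof.
move=> sN; have [vT [p [pT plin]]] := fg_cover X.
have [U UN] := submodule_cover plin sN.
pose h (c : 'rV[Lambda]_(\dim U)) := \sum_(i < \dim U) c 0 i *: p (vbasis U)`_i.
have [|f fh] := @linear_exists Lambda 'rV[Lambda]_(\dim U) X h.
  move=> a x y; rewrite /h scaler_sumr -big_split; apply: eq_bigr => i _ /=.
  by rewrite !mxE scalerDl scalerA.
have [Y [q [i [qT inji iq]]]] := @image_factor (Fgmod (fg_row (\dim U))) X f.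
exists Y, i; split=> //; apply/seteqP; split=> [_ [y _ <-]|x Nx].
  have [c _ <-] : range q y by rewrite qT.
  rewrite iq fh /h; apply: big_ind => [|u v Nu Nv|j _]; first by case: sN.
    by rewrite -[u]scale1r; apply: sN.2.
  rewrite -[_ *: _]addr0; apply: sN.2; last exact: sN.1.
  by apply/UN/vbasis_mem/mem_nth; rewrite size_tuple.
have [v _ pv] : range p x by rewrite pT.
(* Coordinates in [k], seen in [Lambda] as multiples of 1, already reach every element of [N]. *)
pose c := \row_(j < \dim U) (coord (vbasis U) j v)%:A : 'rV[Lambda]_(\dim U).
exists (q c) => //; rewrite iq fh /h -pv.
have /coord_vbasis vE : v \in U by apply/UN; rewrite pv.
rewrite [in RHS]vE.
rewrite (big_morph (fun v => p v) (id1 := 0) (op1 := +%R)).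
- apply: eq_bigr => j _; rewrite mxE.
  by rewrite -[in RHS](addr0 (_ *: _)) plin (semilinear0 plin) addr0.
- by move=> a b; rewrite -[a]scale1r plin !scale1r.
- exact: semilinear0 plin.
Qed.

(** The noetherian property: a member of [S] whose preimage in the cover has the largest dimension
    is maximal for inclusion. *)
Lemma submodule_maximal X (S : set X -> Prop) N0 :
  (forall N, S N -> submodule N) -> S N0 ->
  exists2 N, S N & forall P, S P -> N `<=` P -> P `<=` N.
Proof.
move=> Ssub SN0; have [vT [p [pT plin]]] := fg_cover X.
pose good d := `[< exists N (U : {vspace vT}),
  [/\ S N, forall v, v \in U <-> N (p v) & \dim U = d] >].
have good0 : exists d, good d.
  have [U UN] := submodule_cover plin (Ssub _ SN0).
  by exists (\dim U); apply/asboolP; exists N0, U.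
have goodle d : good d -> (d <= \dim {:vT})%N.
  by move=> /asboolP[_ [U [_ _ <-]]]; exact: dimvS (subvf U).
case: (ex_maxnP good0 goodle) => d /asboolP[N [U [SN UN <-]]] maxU {d}.
exists N => // P SP NP x Px.
have [V VP] := submodule_cover plin (Ssub _ SP).
have le : (\dim V <= \dim U)%N by apply/maxU/asboolP; exists P, V.
have eUV : U = V.
  by apply/eqP; rewrite eqEdim le andbT; apply/subvP => v /UN/NP/VP.
have [v _ pv] : range p x by rewrite pT.
by rewrite -pv; apply/UN; rewrite eUV; apply/VP; rewrite pv.
Qed.

End FiniteLength.

(** * The torsion classes [lperp M] and [Filt (Gen M)] *)

Section TorsionClasses.
Variables (k : fieldType) (Lambda : falgType k).
Implicit Types (X Y Z M : fgmod Lambda) (T U : tors Lambda).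

Lemma bijective_range (X Y : Type) (f : X -> Y) : bijective f -> range f = setT.
Proof.
by case=> g _ gK; apply/seteqP; split=> // y _; exists (g y); rewrite ?gK.
Qed.

Lemma surj_elt (X Y : Type) (f : X -> Y) y :
  range f = setT -> exists x, f x = y.
Proof.
move=> fT; have [x _ <-] : range f y by rewrite fT.
by exists x.
Qed.

Lemma quotient_iso_closed (C : fgmod Lambda -> Prop) :
  quotient_closed C -> iso_closed C.
Proof. by move=> qC X Y f /bijective_range; apply: qC. Qed.

Lemma tors_quotient U X Y (f : {linear X -> Y}) :
  range f = setT -> in_tors U X -> in_tors U Y.
Proof. by have [_ _ + _] := torsP U; apply. Qed.

Lemma tors_extension U X Y Z (f : {linear X -> Y}) (g : {linear Y -> Z}) :
  short_exact f g -> in_tors U X -> in_tors U Z -> in_tors U Y.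
Proof. by have [_ _ _ +] := torsP U; apply. Qed.

Lemma lperp_torsion M : is_torsion_class (lperp M).
Proof.
have qc : quotient_closed (lperp M).
  move=> X Y f fT pX g y; have [x <-] := surj_elt y fT.
  exact: (pX (g \o f : {linear X -> M}) x).
split=> //; last 2 first.
- exact: quotient_iso_closed.
- move=> X Y Z f g [_ fg gT] pX pZ h y.
  have [z|h' h'E] := factor_surj gT (h := h).
    move=> gz; have [x _ <-] : range f z by rewrite fg.
    exact: (pX (h \o f : {linear X -> M}) x).
  by rewrite -h'E pZ.
- exists (Fgmod (fg_zero Lambda)) => f x.
  by rewrite [x]thinmx0 linear0.
Qed.

(** Another description of [Filt (Gen M)], by [Filt_GenE], from which the closure properties are
    easier to read off. *)
Definition trace_class M X := forall Y (g : {linear X -> Y}),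
  range g = setT -> (exists y : Y, y <> 0) ->
  exists (f : {linear M -> Y}) m, f m <> 0.

Lemma trace_class_quotient M : quotient_closed (trace_class M).
Proof.
move=> X Y f fT tX Z g gT nzZ.
apply: (tX Z (g \o f : {linear X -> Z})) nzZ.
apply/seteqP; split=> // z _; have [y <-] := surj_elt z gT.
by have [x <-] := surj_elt y fT; exists x.
Qed.

Lemma trace_class_torsion M : is_torsion_class (trace_class M).
Proof.
split.
- exists (Fgmod (fg_zero Lambda)) => Y g gT [y]; have [x <-] := surj_elt y gT.
  by rewrite [x]thinmx0 linear0.
- exact: quotient_iso_closed (@trace_class_quotient M).
- exact: trace_class_quotient.
- move=> X Y Z f g [_ fg gT] tX tZ W h hT nzW.
  (* Either [h] kills [X], and [W] is a quotient of [Z]; or the image of [X] in [W] is a nonzero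
     quotient of [X], so receives a nonzero map from [M]. *)
  have [fh0|/existsNP[x hfx]] := pselect (forall x, h (f x) = 0).
    have [y|h' h'E] := factor_surj gT (h := h).
      move=> gy; have [x _ <-] : range f y by rewrite fg.
      exact: fh0.
    apply: (tZ W h') nzW; apply/seteqP; split=> // w _.
    by have [y <-] := surj_elt w hT; exists (g y); rewrite ?h'E.
  have [I [p [i [pT inji ip]]]] := image_factor (h \o f : {linear X -> W}).
  have [|r [m rm]] := tX I p pT.
    by exists (p x) => px; apply: hfx; rewrite -[LHS](ip x) px linear0.
  exists (i \o r : {linear M -> W}), m => /= irm; apply: rm.
  by apply: inji; rewrite irm linear0.
Qed.

Lemma trace_class_self M : trace_class M M.
Proof.
by move=> Y g gT [y y0]; have [x gx] := surj_elt y gT; exists g, x; rewrite gx.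
Qed.

(** A maximal submodule [N] satisfying [S] is all of [X]: otherwise [X / N] receives a nonzero map
    from [M], and the preimage of its image is strictly larger than [N]. *)
Lemma trace_class_ind M X (S : set X -> Prop) : trace_class M X ->
  S [set 0] ->
  (forall (N : set X) Z (q : {linear X -> Z}) (f : {linear M -> Z}),
     submodule N -> S N -> range q = setT -> (forall x, q x = 0 <-> N x) ->
     S (q @^-1` range f)) ->
  S setT.
Proof.
move=> tX S0 Sstep; pose S' N := submodule N /\ S N.
have S'0 : S' [set 0].
  by split=> //; split=> // a x y -> ->; rewrite /= scaler0 addr0.
have [N S'N maxN] := submodule_maximal (S := S') (fun N SN => SN.1) S'0.
have [sN SN] := S'N.
have [<-//|neT] := pselect (N = setT).
have [x Nx] : exists x, ~ N x.
  apply: contrapT => /forallNP nN; apply: neT; apply/seteqP.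
  by split=> // x _; apply: contrapT.
have [Z [q [qT qN]]] := cokernel sN.
have [|f [m fm]] := tX Z q qT; first by exists (q x) => /qN.
pose P := q @^-1` range f.
have S'P : S' P.
  by split; [exact/submodule_preimage/submodule_range|exact: Sstep qN].
have NP : N `<=` P.
  by move=> y /qN qy; rewrite /P /preimage /= qy; exists 0; rewrite ?linear0.
have [y qy] := surj_elt (f m) qT.
case: fm; rewrite -qy; apply/qN/(maxN P) => //.
by rewrite /P /preimage /= qy; exists m.
Qed.

(** By [trace_class_ind], [X] is exhausted by submodules lying in [U], since each enlargement is an
    extension by an image of [M]. *)
Lemma trace_class_least M U X : in_tors U M -> trace_class M X -> in_tors U X.
Proof.
move=> UM tX.
suff [Y [i [_ iT UY]]] : exists Y (i : {linear Y -> X}),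
    [/\ injective i, range i = setT & in_tors U Y].
  exact: tors_quotient iT UY.
apply: (@trace_class_ind M X (fun N => exists Y (i : {linear Y -> X}),
    [/\ injective i, range i = N & in_tors U Y])) tX _ _.
  exists (Fgmod (fg_zero Lambda)), \0; split; last exact: tors_zero.
    by move=> x y _; rewrite [x]thinmx0 [y]thinmx0.
  apply/seteqP; split=> [_ [x _ <-]//|_ ->].
  by exists 0.
move=> N Z q f sN [Y [i [inji iN UY]]] qT qN.
have [Y' [i' [inji' i'P]]] :=
  submodule_fg (submodule_preimage q (submodule_range f)).
have [y|j jE] := factor_inj inji' (f := i).
  rewrite i'P /preimage /=; have /qN-> : N (i y) by rewrite -iN; exists y.
  by exists 0; rewrite ?linear0.
have [I [p [e [pT inje ep]]]] := image_factor f.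
have [y|r rE] := factor_inj inje (f := q \o i' : {linear Y' -> Z}).
  have : range i' (i' y) by exists y.
  by rewrite i'P => -[m _ /= <-]; exists (p m); rewrite ?ep.
exists Y', i'; split=> //.
(* The exact sequence is [Y -> Y' -> I], where [Y'] is the preimage under [q] of the image [I] of
   [f]. *)
apply: (tors_extension (f := j) (g := r)) UY (tors_quotient pT UM).
split.
- by move=> y1 y2 e12; apply: inji; rewrite -!jE e12.
- apply/seteqP; split=> [_ [y _ <-]|y ry] /=.
    apply: inje; rewrite rE /= jE linear0; apply/qN.
    by rewrite -iN; exists y.
  have [y1 _ iy1] : range i (i' y).
    by rewrite iN; apply/qN; rewrite -[LHS](rE y) ry linear0.
  by exists y1 => //; apply: inji'; rewrite jE.
- apply/seteqP; split=> // z _; have [m <-] := surj_elt z pT.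
  have [x qx] := surj_elt (f m) qT.
  have [y _ iy] : range i' x by rewrite i'P /preimage /= qx; exists m.
  by exists y => //; apply: inje; rewrite rE /= iy qx ep.
Qed.

Lemma trace_class_Filt M X : trace_class M X -> Filt (Gen M) X.
Proof.
move=> tX; pose S (N : set X) := exists n (F : nat -> set X),
    [/\ forall i, submod_closed (mem (F i)), F 0%N = [set 0], F n = N &
        forall i, (i < n)%N -> F i `<=` F i.+1 /\
          exists2 Z, Gen M Z & subquotient_iso (F i.+1) (F i) Z].
apply: (@trace_class_ind M X S) tX _ _.
  exists 0%N, (fun=> [set 0]); split=> // _; apply: submodule_mem.
  by split=> // a x y -> ->; rewrite /= scaler0 addr0.
move=> N Z q f sN [n [F [sF F0 Fn FS]]] qT qN.
pose P := q @^-1` range f.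
(* [P] is appended as term [n.+1]; the later terms, which must still be submodules, repeat it. *)
exists n.+1, (fun i => if (i <= n)%N then F i else P); split.
- move=> i; case: ifP => // _.
  exact/submodule_mem/submodule_preimage/submodule_range.
- by rewrite leq0n.
- by rewrite ltnn.
move=> i; rewrite ltnS => lein.
have /predU1P[->|ltin] : (i == n) || (i < n)%N by rewrite -leq_eqVlt.
  2: by rewrite /= ltin lein; apply: FS.
rewrite /= leqnn ltnn Fn; split.
  by move=> x /qN qx; rewrite /P /preimage /= qx; exists 0; rewrite ?linear0.
have [I [p [e [pT inje ep]]]] := image_factor f.
exists I.
  have [|g gE] := @linear_exists _ {ffun 'I_1 -> M} I (fun v => p (v ord0)).
    by move=> a u v; rewrite !ffunE linearP.
  exists 1%N, g; apply/seteqP; split=> // z _; have [m <-] := surj_elt z pT.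
  by exists [ffun=> m]; rewrite ?gE ?ffunE.
(* On [P], [g] is [q] read in [I]; elsewhere 0 is a default value. *)
have /choice[g gE] : forall x, exists z, P x -> e z = q x.
  move=> x; have [[m _ fm]|nPx] := pselect (P x); last by exists 0.
  by exists (p m); rewrite ep fm.
have sP : submodule P by exact/submodule_preimage/submodule_range.
exists g; split.
- move=> a x y Px Py; apply: inje; rewrite linearP !gE// ?linearP//.
  exact: sP.2.
- apply/seteqP; split=> // z _; have [m pm] := surj_elt z pT.
  have [x qx] := surj_elt (f m) qT.
  have Px : P x by rewrite /P /preimage /= qx; exists m.
  by exists x => //; apply: inje; rewrite gE// qx -ep pm.
- move=> x Px; rewrite -qN -gE//; split=> [->|egx]; first exact: linear0.
  by apply: inje; rewrite egx linear0.
Qed.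

(** A nonzero map from a quotient of a power of [M] stays nonzero on one of the copies of [M]. *)
Lemma Gen_hom_neq0 M X Y (h : {linear X -> Y}) x : Gen M X -> h x <> 0 ->
  exists (f : {linear M -> Y}) m, f m <> 0.
Proof.
move=> [n [p pT]]; have [v <-] := surj_elt x pT => hpv.
apply: contrapT => nf; apply: hpv.
have -> : v = \sum_j [ffun l => if l == j then v j else 0].
  apply/ffunP => l; rewrite sum_ffunE (bigD1 l) //= ffunE eqxx.
  rewrite big1 ?addr0// => j.
  by rewrite ffunE eq_sym => /negPf->.
rewrite !linear_sum big1 // => j _.
have [|i iE] := @linear_exists _ M {ffun 'I_n -> M}
    (fun m => [ffun l => if l == j then m else 0]).
  move=> a u w; apply/ffunP => l; rewrite !ffunE.
  by case: ifP; rewrite ?scaler0 ?addr0.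
rewrite -iE; apply: contrapT => hpi; apply: nf.
by exists (h \o (p \o i) : {linear M -> Y}), (v j).
Qed.

(** Let [F j.+1] be the first term of the filtration not killed by [g]. Then [g] induces a nonzero
    map to [Y] from the factor [F j.+1 / F j], which is in [Gen M]. *)
Lemma Filt_trace_class M X : Filt (Gen M) X -> trace_class M X.
Proof.
move=> [n [F [sF F0 Fn FS]]] Y g gT [y y0].
have submF i : submodule (F i).
  have [z c] := sF i; split; first exact/set_mem.
  by move=> a u v Fu Fv; apply/set_mem/c; apply/mem_set.
pose bad i := `[< exists2 x, F i x & g x <> 0 >].
have badn : bad n.
  by apply/asboolP; have [x gx] := surj_elt y gT; exists x; rewrite ?Fn ?gx.
have exbad : exists i, bad i by exists n.
case: (ex_minnP exbad) => -[|j] /asboolP[x Fx gx] minj.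
  by case: gx; move: Fx; rewrite F0 => ->; rewrite linear0.
have gF u : F j u -> g u = 0.
  move=> Fu; apply: contrapT => gu.
  by have := minj j (asboolT (ex_intro2 _ _ u Fu gu)); rewrite ltnn.
have [FjS [Z GZ [s [slin sT sN]]]] := FS j (minj _ badn).
(* [h z] is the common value of [g] on the fibre of [s] over [z] in [F j.+1]: two points of the
   fibre differ by an element of [F j]. *)
have /choice[h hE] : forall z, exists y, forall u,
    F j.+1 u -> s u = z -> g u = y.
  move=> z; have [u Fu su] : (s @` F j.+1) z by rewrite sT.
  exists (g u) => w Fw sw; apply/eqP; rewrite -subr_eq0 -linearB; apply/eqP/gF.
  rewrite addrC -scaleN1r; apply/sN; first exact: (submF _).2.
  by rewrite slin// sw su scaleN1r addNr.
have [|h' h'E] := @linear_exists _ Z Y h.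
  move=> a z1 z2.
  have [u Fu su] : (s @` F j.+1) z1 by rewrite sT.
  have [w Fw sw] : (s @` F j.+1) z2 by rewrite sT.
  rewrite -(hE z1 u)// -(hE z2 w)// -linearP; apply/esym/hE.
    exact: (submF _).2.
  by rewrite slin// su sw.
by apply: (Gen_hom_neq0 (h := h') (x := s x)) GZ _; rewrite h'E -(hE _ x).
Qed.

Lemma Filt_GenE M X : Filt (Gen M) X <-> trace_class M X.
Proof. by split=> [/Filt_trace_class|/trace_class_Filt]. Qed.

End TorsionClasses.

(** * The kappa map at the torsion class of a brick *)

Section Kappa.
Variables (k : fieldType) (Lambda : falgType k).
Implicit Types (X Y Z : fgmod Lambda) (U V : tors Lambda).

Definition trace_tors M : tors Lambda :=
  TorsionClass (@trace_class_torsion k Lambda M).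
Definition lperp_tors M : tors Lambda :=
  TorsionClass (@lperp_torsion k Lambda M).

Lemma trace_tors_le M U : ple (trace_tors M) U <-> in_tors U M.
Proof.
split=> [|UM X]; last exact: trace_class_least.
by apply; apply: trace_class_self.
Qed.

Variable M : fgmod Lambda.
Hypothesis brickM : brick M.

Lemma brick_notin_lperp : ~ lperp M M.
Proof. by have [[x x0] _] := brickM => /(_ idfun x). Qed.

Lemma brick_bij (f : {linear M -> M}) x : f x <> 0 -> bijective f.
Proof.
by move=> fx; have [|g [fK gK]] := brickM.2 f; [exists x | exists g].
Qed.

(** By [trace_tors_le], the hypotheses say that [U] is strictly below [trace_tors M]. *)
Lemma le_lperp_of_lt U : ple U (trace_tors M) -> ~ in_tors U M ->
  ple U (lperp_tors M).
Proof.
move=> UJ nUM X UX f x; apply: contrapT => fx; apply: nUM.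
have [I [p [i [pT inji ip]]]] := image_factor f.
have UI := tors_quotient pT UX.
(* [I] is tested as a nonzero quotient of itself. *)
have [||h [m hm]] := UJ I UI I idfun.
- by apply/seteqP; split=> // y _; exists y.
- by exists (p x) => px; apply: fx; rewrite -ip px linear0.
have ihm : (i \o h : {linear M -> M}) m <> 0.
  by move=> /= ihm; apply: hm; apply: inji; rewrite ihm linear0.
have /bijective_range ihT := brick_bij ihm.
apply: (tors_quotient (f := i)) UI; apply/seteqP; split=> // y _.
by have [z <-] := surj_elt y ihT; exists (h z).
Qed.

(** If the join were not in [A], every member of [A] would be strictly below it, hence below
    [lperp_tors M]; then so would the join, which contains [M]. *)
Lemma trace_tors_cji : completely_join_irreducible (trace_tors M).
Proof.
move=> A [ubA lubA]; apply: contrapT => nAJ.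
apply: brick_notin_lperp; apply: (trace_tors_le M (lperp_tors M)).1.
apply: lubA => U AU; apply: le_lperp_of_lt; first exact: ubA.
move=> /trace_tors_le JU; apply: nAJ.
by rewrite (ple_anti JU (ubA _ AU)).
Qed.

(** The first hypothesis puts [U] above the intersection that [kappa_trace_tors] shows to be the
    lower star. *)
Lemma le_lperp_of_ge U :
  (forall X, trace_class M X -> lperp M X -> in_tors U X) -> ~ in_tors U M ->
  ple U (lperp_tors M).
Proof.
move=> sU nUM X UX f x; apply: contrapT => fx; apply: nUM.
have [I [p [i [pT inji ip]]]] := image_factor f.
have UI := tors_quotient pT UX.
have [Z [q [qT qi]]] := cokernel (submodule_range i).
apply: (tors_extension (f := i) (g := q)) UI _.
  by split=> //; apply/seteqP; split=> y /qi.
(* [Z] is [M / I]; a nonzero map from it to [M] would give a nonzero endomorphism of [M] killing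
   [I], against injectivity. *)
apply: sU; first exact: trace_class_quotient qT (@trace_class_self _ _ M).
move=> g z; have [y <-] := surj_elt z qT; apply: contrapT => gqy.
have /brick_bij/bij_inj inj : (g \o q : {linear M -> M}) y <> 0 by [].
apply: fx; apply: inj => /=; rewrite !linear0 (_ : q _ = 0) ?linear0//.
by apply/qi; exists (p x).
Qed.

Lemma kappa_trace_tors : is_kappa (trace_tors M) (lperp_tors M).
Proof.
split; first exact: trace_tors_cji.
(* The candidate lower star is the meet of [trace_tors M] and [lperp_tors M]. *)
have [Js [lbJs _] JsE] :=
  tors_meet (fun U => U = trace_tors M \/ U = lperp_tors M).
have JsJ : ple Js (trace_tors M) by apply: lbJs; left.
have JsP : ple Js (lperp_tors M) by apply: lbJs; right.
have ltJs U : plt U (trace_tors M) -> ple U Js.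
  move=> [UJ neUJ] X UX; rewrite JsE => _ [->|->]; first exact: UJ.
  apply: le_lperp_of_lt UX => // /trace_tors_le JU.
  exact/neUJ/ple_anti.
have cov : covers (trace_tors M) Js.
  split=> [|U [[JsU neJsU] /ltJs UJs]]; last exact/neJsU/ple_anti.
  split=> // eJs; apply: brick_notin_lperp; apply: JsP.
  by rewrite eJs; apply: trace_class_self.
exists Js; split.
(* Were another [U] covered, [Js] would lie strictly between [U] and [trace_tors M]. *)
- split=> // U [UJ covU]; apply: contrapT => neU.
  by apply: (covU Js); split; [split=> //; exact: ltJs|exact: cov.1].
- by split=> // /trace_tors_le; exact: brick_notin_lperp.
- move=> U JsU /trace_tors_le nUM; apply: le_lperp_of_ge => // X JX PX.
  by apply: JsU; rewrite JsE => _ [->|->].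
Qed.

End Kappa.

Theorem propositionB (k : fieldType) (Lambda : falgType k) (T : tors Lambda)
    (A : Type) (M : A -> fgmod Lambda)
    (brickM : forall a : A, brick (M a))
    (cjrT : is_CJR T
      (fun U : tors Lambda =>
         exists a : A, forall X, in_tors U X <-> Filt (Gen (M a)) X)) :
  exists2 K : tors Lambda,
    is_kappabar T K &
    forall X, in_tors K X <-> (forall a : A, lperp (M a) X).
Proof.
(* Joinands are given only by their objects; this makes [kappa_trace_tors] applicable to them. *)
have joinandE (U : tors Lambda) a :
    (forall X, in_tors U X <-> Filt (Gen (M a)) X) -> U = trace_tors (M a).
  by move=> UE; apply: ple_anti => X /=; rewrite /= -Filt_GenE UE.
set J := (fun U => _) in cjrT.
have [K meetK KE] := tors_meet (fun V => exists2 U, J U & is_kappa U V).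
exists K; first exists J.
  split=> // U [a /joinandE->]; exists (lperp_tors (M a)).
  exact: kappa_trace_tors.
move=> X; rewrite KE; split=> [KX a|pX V [_ [a /joinandE->]]].
  apply: (KX (lperp_tors (M a))); exists (trace_tors (M a)).
    by exists a => Y; rewrite Filt_GenE.
  exact: kappa_trace_tors.
(* Uniqueness of kappa forces [V] to be [lperp_tors (M a)]. *)
by move=> /(is_kappa_unique (kappa_trace_tors (brickM a))) <-; apply: pX.
Qed.
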